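(* Linear index codes are optimal for all single-uniprior index coding problems: for every information-flow graph $\mathcal{G}$ on $n$ vertices, representing a single-uniprior index coding problem, there exists an index code for $\mathcal{G}$ of length $\ell^*(\mathcal{G})$ whose encoding function $E:\{0,1\}^n\to\{0,1\}^{\ell^*(\mathcal{G})}$ is linear over $\mathbb{F}_2$.
   Context: Single-uniprior index coding problem: a sender holds $n$ message bits $x_1,\dots,x_n\in\{0,1\}$ (independent, uniformly distributed), and there are $n$ receivers; receiver $j$ knows exactly the bit $x_j$ a priori and wants a set $\mathcal{W}_j$ of message bits, $x_j\notin\mathcal{W}_j$. The problem is represented by its information-flow graph, the finite directed graph $\mathcal{G}=(\mathcal{V},\mathcal{A})$ with $\mathcal{V}=\{1,\dots,n\}$ and with an arc $(i,j)\in\mathcal{A}$ (tail $i$, head $j$) if and only if $x_i\in\mathcal{W}_j$. Standing assumptions on information-flow graphs: no loops, at most one arc for each ordered pair of vertices (both $(i,j)$ and $(j,i)$ may be present), and every vertex is incident with at least one arc, so there are at least two vertices and at least one arc. An index code of length $\ell$ for $\mathcal{G}$ consists of an encoding function $E:\{0,1\}^n\to\{0,1\}^\ell$ and, for each receiver $j$, a decoding function $D_j:\{0,1\}^{\ell+1}\to\{0,1\}^{|\mathcal{W}_j|}$ such that $D_j(E(x),x_j)=(x_i)_{i:(i,j)\in\mathcal{A}}$ for every $x=(x_1,\dots,x_n)\in\{0,1\}^n$. $\ell^*(\mathcal{G})$ is the smallest integer $\ell$ for which an index code of length $\ell$ exists. The set $\{0,1\}$ is identified with the field $\mathbb{F}_2$,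 and an index code is linear if its encoding function is $\mathbb{F}_2$-linear. *)

(* Defs.v *)
From HB Require Import structures.
From mathcomp Require Import all_boot all_order all_algebra.
From mathcomp Require Import boolp.

Set Implicit Arguments.
Unset Strict Implicit.
Unset Printing Implicit Defensive.

Import GRing.Theory.
Local Open Scope ring_scope.

(* [arc i j] holds when receiver j wants the bit x_i. *)
Definition information_flow_graph (n : nat) (arc : rel 'I_n) : Prop :=
  [/\ (0 < n)%N, irreflexive arc & forall i, exists j, arc i j || arc j i].

Definition wanted (n : nat) (arc : rel 'I_n) (j : 'I_n) : {set 'I_n} :=
  [set i | arc i j].

Definition wanted_bits (n : nat) (arc : rel 'I_n) (j : 'I_n)
    (x : 'rV['F_2]_n) : 'rV['F_2]_(#|wanted arc j|) :=
  \row_k x 0 (enum_val k).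

(* The input of the decoder of receiver j is the codeword followed by x_j. *)
Definition is_index_code (n : nat) (arc : rel 'I_n) (l : nat)
    (E : 'rV['F_2]_n -> 'rV['F_2]_l)
    (D : forall j : 'I_n, 'rV['F_2]_(l + 1) -> 'rV['F_2]_(#|wanted arc j|)) :
    Prop :=
  forall (j : 'I_n) (x : 'rV['F_2]_n),
    D j (row_mx (E x) (const_mx (x 0 j))) = wanted_bits arc j x.

Definition has_index_code (n : nat) (arc : rel 'I_n) (l : nat) : Prop :=
  exists (E : 'rV['F_2]_n -> 'rV['F_2]_l)
         (D : forall j : 'I_n,
                'rV['F_2]_(l + 1) -> 'rV['F_2]_(#|wanted arc j|)),
    is_index_code E D.

Lemma index_code_exists (n : nat) (arc : rel 'I_n) :
  exists l, `[< has_index_code arc l >].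
Proof.
exists n; apply/asboolP; exists id, (fun j y => wanted_bits arc j (lsubmx y)).
by move=> j x; rewrite row_mxKl.
Qed.

Definition optimal_length (n : nat) (arc : rel 'I_n) : nat :=
  ex_minn (index_code_exists arc).

(* Main.v *)
Require Import Defs.
From HB Require Import structures.
From mathcomp Require Import all_boot all_order all_algebra.
From mathcomp Require Import boolp.

(** Choose a minimal set R of vertices such that every vertex has a directed
path into R; no two distinct members of R are then connected. For any index
code, E(x) together with the bits of x indexed by R determines x, by decoding
backwards along arcs, so every code has length at least n - |R|. Conversely,
send x_v + x_r for every v outside R that is reachable from some (necessarily
unique) r in R, and x_v for every other v outside R. Along an arc (i, j), if r
reaches i then it reaches j, and receiver j gets x_i as
(x_i + x_r) + (x_j + x_r) + x_j. This code is linear of length n - |R|. *)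

Set Implicit Arguments.
Unset Strict Implicit.
Unset Printing Implicit Defensive.

Import GRing.Theory.
Local Open Scope ring_scope.

Section ReachedSets.
Variables (T : finType) (e : rel T).

Definition reached (R : {set T}) : bool :=
  [forall v, exists r in R, connect e v r].

Lemma reachedP (R : {set T}) :
  reflect (forall v, exists2 r, r \in R & connect e v r) (reached R).
Proof. exact: 'forall_exists_inP. Qed.

Lemma minset_reached_exists : exists R, minset reached R.
Proof.
have /minset_exists[R minR _] : reached setT.
  by apply/reachedP => v; exists v; rewrite ?inE.
by exists R.
Qed.

Variable R : {set T}.
Hypothesis minR : minset reached R.

(** If [r] and [s] were distinct, every vertex with a path to [r] would still reach [s], so [R :\ r]
    would contradict minimality. *)
Lemma minset_reached_antichain r s :
  r \in R -> s \in R -> connect e r s -> r = s.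
Proof.
move=> rR sR rs; apply/eqP/contraT => neq_rs.
have reachedD1 : reached (R :\ r).
  apply/reachedP => v.
  have /reachedP/(_ v)[t tR vt] := minsetp minR.
  have [eq_tr|neq_tr] := eqVneq t r.
    exists s; first by rewrite !inE eq_sym neq_rs.
    by apply: connect_trans rs; rewrite -eq_tr.
  by exists t; rewrite // !inE neq_tr.
have /setP/(_ r) := minsetinf minR reachedD1 (subsetDl _ _).
by rewrite !inE eqxx rR.
Qed.

Lemma minset_reached_source_uniq r s v :
  r \in R -> s \in R -> connect e r v -> connect e s v -> r = s.
Proof.
move=> rR sR rv sv; have /reachedP/(_ v)[t tR vt] := minsetp minR.
rewrite (minset_reached_antichain rR tR (connect_trans rv vt)).
by rewrite (minset_reached_antichain sR tR (connect_trans sv vt)).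
Qed.

End ReachedSets.

Section IndexCodes.
Variables (n : nat) (arc : rel 'I_n).

(** A decoder-free condition on [E], equivalent to the existence of decoders. *)
Definition decodable (l : nat) (E : 'rV['F_2]_n -> 'rV['F_2]_l) : Prop :=
  forall i j x y, arc i j -> E x = E y -> x 0 j = y 0 j -> x 0 i = y 0 i.

Lemma index_code_decodable l (E : 'rV['F_2]_n -> 'rV['F_2]_l)
    (D : forall j, 'rV['F_2]_(l + 1) -> 'rV['F_2]_(#|wanted arc j|)) :
  is_index_code E D -> decodable E.
Proof.
move=> ED i j x y ij Exy xyj.
have i_wanted : i \in wanted arc j by rewrite inE.
have : wanted_bits arc j x = wanted_bits arc j y by rewrite -!ED Exy xyj.
move/rowP/(_ (enum_rank_in i_wanted i)).
by rewrite !mxE enum_rankK_in.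
Qed.

Lemma decodable_index_code l (E : 'rV['F_2]_n -> 'rV['F_2]_l) :
  decodable E ->
  exists D : forall j, 'rV['F_2]_(l + 1) -> 'rV['F_2]_(#|wanted arc j|),
    is_index_code E D.
Proof.
move=> decE.
pose received j x : 'rV['F_2]_(l + 1) := row_mx (E x) (const_mx (x 0 j)).
(* Any message consistent with the received word yields the right wanted bits; words never received
   are sent to 0. *)
exists (fun j c =>
  if [pick x | received j x == c] is Some x then wanted_bits arc j x else 0).
move=> j x; case: pickP => [y /eqP/eq_row_mx[Eyx yxj]|/(_ x)]; last first.
  by rewrite eqxx.
apply/rowP => k; rewrite !mxE.
apply: (decE _ j) Eyx _; first by have := enum_valP k; rewrite inE.
by have /rowP/(_ 0) := yxj; rewrite !mxE.
Qed.

Lemma decodable_length (R : {set 'I_n}) l (E : 'rV['F_2]_n -> 'rV['F_2]_l) :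
  reached arc R -> decodable E -> (#|~: R| <= l)%N.
Proof.
move=> /reachedP reachedR decE.
pose f x : 'rV['F_2]_l * 'rV['F_2]_#|R| := (E x, \row_k x 0 (enum_val k)).
have f_inj : injective f.
  move=> x y [Exy xyR]; apply/rowP => v.
  have [r rR /connectP[p]] := reachedR v.
  (* Agreement at the end of the path, in [R], propagates back arc by arc to [v]. *)
  elim: p v => [v _ def_r|w p IHp v /= /andP[vw wp] def_r]; last first.
    exact: decE vw Exy (IHp w wp def_r).
  have /rowP/(_ (enum_rank_in rR r)) := xyR.
  by rewrite !mxE enum_rankK_in // def_r.
have := leq_card f f_inj.
rewrite card_prod !card_mx card_Fp // !mul1n -expnD leq_exp2l //.
by rewrite -{1}[n]card_ord -(cardsC R) addnC leq_add2r.
Qed.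

Section SourceCode.
Variable R : {set 'I_n}.
Hypothesis minR : minset (reached arc) R.

(** For minimal [R] at most one term occurs; the sum form covers unreached vertices with value 0 and
    is visibly linear in [x]. *)
Definition source_sum (v : 'I_n) (x : 'rV['F_2]_n) : 'F_2 :=
  \sum_(r in R | connect arc r v) x 0 r.

Definition source_code (x : 'rV['F_2]_n) : 'rV['F_2]_#|~: R| :=
  \row_k (x 0 (enum_val k) + source_sum (enum_val k) x).

Lemma source_sum_eq r v x :
  r \in R -> connect arc r v -> source_sum v x = x 0 r.
Proof.
move=> rR rv; rewrite /source_sum (big_pred1 r) // => s.
apply/andP/eqP => [[sR sv]|->] //.
exact: (minset_reached_source_uniq minR sR rR sv rv).
Qed.

Lemma source_code_linear : linear source_code.
Proof.
move=> a x y; apply/rowP => k; rewrite !mxE mulrDr addrACA; congr (_ + _).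
rewrite /source_sum mulr_sumr -big_split; apply: eq_bigr => r _.
by rewrite !mxE.
Qed.

(* On R the sum is x_r + x_r = 0, so the code need not carry it. *)
Lemma source_code_sum x y v : source_code x = source_code y ->
  x 0 v + source_sum v x = y 0 v + source_sum v y.
Proof.
move=> Exy; have [vR|vNR] := boolP (v \in R).
  rewrite !(source_sum_eq _ vR (connect0 _ _)).
  by rewrite !(addrr_pchar2 (pchar_Fp (isT : prime 2))).
have vCR : v \in ~: R by rewrite inE.
have /rowP/(_ (enum_rank_in vCR v)) := Exy.
by rewrite !mxE enum_rankK_in.
Qed.

Lemma source_code_decodable : decodable source_code.
Proof.
move=> i j x y ij Exy xyj.
have := source_code_sum i Exy.
case: (pickP (fun r => (r \in R) && connect arc r i)) => [r|noR]; last first.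
  by rewrite /source_sum !big_pred0 // !addr0.
case/andP=> rR ri; have rj := connect_trans ri (connect1 ij).
(* The same [r] serves [i] and [j]: the known bit at [j] reveals the bit at [r], which then reveals
   the bit at [i]. *)
have := source_code_sum j Exy.
rewrite !(source_sum_eq _ rR ri) !(source_sum_eq _ rR rj) xyj.
by move=> /addrI -> /addIr.
Qed.

Lemma optimal_lengthE : optimal_length arc = #|~: R|.
Proof.
rewrite /optimal_length; case: ex_minnP => l /asboolP[E [D ED]] min_l.
apply/eqP; rewrite eqn_leq min_l; last first.
  apply/asboolP; exists source_code.
  exact: decodable_index_code source_code_decodable.
exact: decodable_length (minsetp minR) (index_code_decodable ED).
Qed.

End SourceCode.
End IndexCodes.

Theorem mainTheorem2 (n : nat) (arc : rel 'I_n)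
    (arc_ifg : information_flow_graph arc) :
  exists (E : 'rV['F_2]_n -> 'rV['F_2]_(optimal_length arc))
         (D : forall j : 'I_n,
                'rV['F_2]_(optimal_length arc + 1) ->
                'rV['F_2]_(#|wanted arc j|)),
    is_index_code E D /\ linear E.
Proof.
have [R minR] := minset_reached_exists arc.
(* The length occurs in the types of [E] and [D], so it is replaced before the witnesses are
   given. *)
rewrite (optimal_lengthE minR).
have [D ED] := decodable_index_code (source_code_decodable minR).
by exists (source_code arc R), D; split=> //; apply: source_code_linear.
Qed.
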